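(* The full simply-typed $\lambda$-calculus $\lambda_{\to,\wedge,\vee,\bot}$ is strongly normalizing: for every term $M$ of $\lambda_{\to,\wedge,\vee,\bot}$ there is no infinite sequence $M = M_0 \to M_1 \to M_2 \to \cdots$, where $\to$ is the union of $\beta$-reduction $\to_\beta$ and commutative (permutative) reduction $\rightsquigarrow$.
   Context: Types of $\lambda_{\to,\wedge,\vee,\bot}$: $\sigma,\tau ::= p, q, \ldots \mid \sigma\to\tau \mid \sigma\wedge\tau \mid \sigma\vee\tau \mid \bot$, where $p,q,\ldots$ are type constants. Terms are in Church style (a superscript indicates the type of a term) and are considered up to $\alpha$-conversion. They are: variables $x^\sigma$; introductions $(\lambda x^\sigma.N^\tau)^{\sigma\to\tau}$, $\langle M^\sigma,N^\tau\rangle^{\sigma\wedge\tau}$, $(\mathtt{in}_1 A^\sigma)^{\sigma\vee\tau}$, $(\mathtt{in}_2 B^\tau)^{\sigma\vee\tau}$; eliminations $(M^{\sigma\to\tau}N^\sigma)^\tau$, $(P^{\sigma\wedge\tau}\pi_1)^\sigma$, $(P^{\sigma\wedge\tau}\pi_2)^\tau$, $(W^{\sigma\vee\tau}[x^\sigma.S^\delta,y^\tau.T^\delta])^\delta$ (case analysis, $x$ bound in $S$ and $y$ bound in $T$), $(A^\bot\epsilon_\tau)^\tau$ (ex falso). An eliminator $E$ is any of: a term $N$ (application), $\pi_1$, $\pi_2$, $[a.A,b.B]$, $\epsilon_\alpha$; an elimination term is written $ME$. $\beta$-rules: $(\lambda x^\tau.M)A \to_\beta M[x:=A]$; $\langle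 M,N\rangle\pi_1\to_\beta M$; $\langle M,N\rangle\pi_2\to_\beta N$; $(\mathtt{in}_1 A)[x.S,y.T]\to_\beta S[x:=A]$; $(\mathtt{in}_2 B)[x.S,y.T]\to_\beta T[y:=B]$. Commutative rules, for every eliminator $E$ such that the left-hand side is well typed (bound variables renamed to avoid capture): (1) $(W[x.S,y.T])E \rightsquigarrow W[x.SE,\,y.TE]$; (2) $(A^\bot\epsilon_\rho)E \rightsquigarrow A\,\epsilon_{\rho'}$, where $\rho'$ is the type of $(A\epsilon_\rho)E$ (this includes $(A\epsilon_\bot)\epsilon_\sigma\rightsquigarrow A\epsilon_\sigma$). Both $\to_\beta$ and $\rightsquigarrow$ denote the compatible closures of these rules, i.e. a rule may be applied to any subterm. *)

(* Defs.v *)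
From Stdlib Require Import List Relations.
Import ListNotations.

Set Implicit Arguments.
Unset Strict Implicit.

(* [P] is the set of type constants; it is left arbitrary throughout. *)
Inductive ty (P : Type) : Type :=
| Const : P -> ty P
| Arr : ty P -> ty P -> ty P
| And : ty P -> ty P -> ty P
| Or : ty P -> ty P -> ty P
| Bot : ty P.

Arguments Bot {P}.

(* [var G s] is the type of positions of [s] in the list [G] of typed variables
   in scope, the head being the most recently bound one (de Bruijn indices). *)
Inductive var (P : Type) : list (ty P) -> ty P -> Type :=
| VZ : forall G s, var (s :: G) s
| VS : forall G s t, var G s -> var (t :: G) s.

Arguments VZ {P G s}.

(* Church-style terms modulo alpha-conversion: [tm G s] consists of the terms of
   type [s] whose free variables are among those declared in [G].  The type
   superscripts of the informal syntax are the indices of the family. *)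
Inductive tm (P : Type) : list (ty P) -> ty P -> Type :=
| Var : forall G s, var G s -> tm G s
| Lam : forall G s t, tm (s :: G) t -> tm G (Arr s t)
| Pair : forall G s t, tm G s -> tm G t -> tm G (And s t)
| In1 : forall G s t, tm G s -> tm G (Or s t)
| In2 : forall G s t, tm G t -> tm G (Or s t)
| App : forall G s t, tm G (Arr s t) -> tm G s -> tm G t
| Pi1 : forall G s t, tm G (And s t) -> tm G s
| Pi2 : forall G s t, tm G (And s t) -> tm G t
| Case : forall G s t d,
    tm G (Or s t) -> tm (s :: G) d -> tm (t :: G) d -> tm G d
| Eps : forall G t, tm G Bot -> tm G t.

Arguments In1 {P G s} t _.
Arguments In2 {P G} s {t} _.
Arguments Eps {P G} t _.

Definition renaming (P : Type) (G D : list (ty P)) : Type :=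
  forall s, var G s -> var D s.

Definition ren_up (P : Type) (G D : list (ty P)) (u : ty P)
    (r : renaming G D) : renaming (u :: G) (u :: D) :=
  fun s x =>
    match x in var G' s' return
      match G' with
      | [] => unit
      | u' :: G0 => renaming G0 D -> var (u' :: D) s'
      end
    with
    | VZ => fun _ => VZ
    | VS _ y => fun r => VS _ (r _ y)
    end r.

Fixpoint rename (P : Type) (G D : list (ty P)) (s : ty P)
    (r : renaming G D) (M : tm G s) {struct M} : tm D s :=
  match M in tm G' s' return renaming G' D -> tm D s' with
  | Var x => fun r => Var (r _ x)
  | Lam N => fun r => Lam (rename (ren_up r) N)
  | Pair M N => fun r => Pair (rename r M) (rename r N)
  | In1 t A => fun r => In1 t (rename r A)
  | In2 s B => fun r => In2 s (rename r B)
  | App M N => fun r => App (rename r M) (rename r N)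
  | Pi1 A => fun r => Pi1 (rename r A)
  | Pi2 A => fun r => Pi2 (rename r A)
  | Case W K L => fun r =>
      Case (rename r W) (rename (ren_up r) K) (rename (ren_up r) L)
  | Eps t A => fun r => Eps t (rename r A)
  end r.

Definition weaken (P : Type) (G : list (ty P)) (u s : ty P) (M : tm G s) :
    tm (u :: G) s :=
  rename (fun s x => VS u x) M.

Definition substitution (P : Type) (G D : list (ty P)) : Type :=
  forall s, var G s -> tm D s.

Definition subst_up (P : Type) (G D : list (ty P)) (u : ty P)
    (f : substitution G D) : substitution (u :: G) (u :: D) :=
  fun s x =>
    match x in var G' s' return
      match G' with
      | [] => unit
      | u' :: G0 => substitution G0 D -> tm (u' :: D) s'
      end
    with
    | VZ => fun _ => Var VZ
    | VS _ y => fun f => weaken _ (f _ y)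
    end f.

Fixpoint subst (P : Type) (G D : list (ty P)) (s : ty P)
    (f : substitution G D) (M : tm G s) {struct M} : tm D s :=
  match M in tm G' s' return substitution G' D -> tm D s' with
  | Var x => fun f => f _ x
  | Lam N => fun f => Lam (subst (subst_up f) N)
  | Pair M N => fun f => Pair (subst f M) (subst f N)
  | In1 t A => fun f => In1 t (subst f A)
  | In2 s B => fun f => In2 s (subst f B)
  | App M N => fun f => App (subst f M) (subst f N)
  | Pi1 A => fun f => Pi1 (subst f A)
  | Pi2 A => fun f => Pi2 (subst f A)
  | Case W K L => fun f =>
      Case (subst f W) (subst (subst_up f) K) (subst (subst_up f) L)
  | Eps t A => fun f => Eps t (subst f A)
  end f.

Definition single (P : Type) (G : list (ty P)) (u : ty P) (A : tm G u) :
    substitution (u :: G) G :=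
  fun s x =>
    match x in var G' s' return
      match G' with
      | [] => unit
      | u' :: G0 => tm G0 u' -> tm G0 s'
      end
    with
    | VZ => fun A => A
    | VS _ y => fun _ => Var y
    end A.

(* [subst0 M A] is M[x:=A], where x is the last variable bound over [M]. *)
Definition subst0 (P : Type) (G : list (ty P)) (u s : ty P)
    (M : tm (u :: G) s) (A : tm G u) : tm G s :=
  subst (single A) M.

(* [elim G s t]: the eliminators E such that M E has type [t] for M of type
   [s]. *)
Inductive elim (P : Type) (G : list (ty P)) : ty P -> ty P -> Type :=
| EApp : forall s t, tm G s -> elim G (Arr s t) t
| EPi1 : forall s t, elim G (And s t) s
| EPi2 : forall s t, elim G (And s t) t
| ECase : forall s t d, tm (s :: G) d -> tm (t :: G) d -> elim G (Or s t) d
| EEps : forall t, elim G Bot t.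

Arguments EApp {P G s} t _.
Arguments EPi1 {P G} s t.
Arguments EPi2 {P G} s t.
Arguments EEps {P G} t.

Definition elim_tm (P : Type) (G : list (ty P)) (s t : ty P)
    (M : tm G s) (E : elim G s t) : tm G t :=
  match E in elim _ s' t' return tm G s' -> tm G t' with
  | EApp _ N => fun M => App M N
  | EPi1 _ _ => fun M => Pi1 M
  | EPi2 _ _ => fun M => Pi2 M
  | ECase K L => fun M => Case M K L
  | EEps t => fun M => Eps t M
  end M.

Definition weaken_elim (P : Type) (G : list (ty P)) (u s t : ty P)
    (E : elim G s t) : elim (u :: G) s t :=
  match E in elim _ s' t' return elim (u :: G) s' t' with
  | EApp t N => EApp t (weaken u N)
  | EPi1 s t => EPi1 s t
  | EPi2 s t => EPi2 s t
  | ECase K L =>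
      ECase (rename (ren_up (fun s x => VS u x)) K)
            (rename (ren_up (fun s x => VS u x)) L)
  | EEps t => EEps t
  end.

Inductive beta_rule (P : Type) (G : list (ty P)) :
    forall s : ty P, relation (tm G s) :=
| beta_lam : forall s t (M : tm (s :: G) t) (A : tm G s),
    beta_rule (App (Lam M) A) (subst0 M A)
| beta_pi1 : forall s t (M : tm G s) (N : tm G t),
    beta_rule (Pi1 (Pair M N)) M
| beta_pi2 : forall s t (M : tm G s) (N : tm G t),
    beta_rule (Pi2 (Pair M N)) N
| beta_in1 : forall s t d (A : tm G s) (K : tm (s :: G) d) (L : tm (t :: G) d),
    beta_rule (Case (In1 t A) K L) (subst0 K A)
| beta_in2 : forall s t d (B : tm G t) (K : tm (s :: G) d) (L : tm (t :: G) d),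
    beta_rule (Case (In2 s B) K L) (subst0 L B).

(* Weakening [E] under the binders of the case analysis is the renaming of bound
   variables that avoids capture. *)
Inductive comm_rule (P : Type) (G : list (ty P)) :
    forall s : ty P, relation (tm G s) :=
| comm_case : forall s t d e (W : tm G (Or s t))
      (K : tm (s :: G) d) (L : tm (t :: G) d) (E : elim G d e),
    comm_rule (elim_tm (Case W K L) E)
              (Case W (elim_tm K (weaken_elim s E))
                      (elim_tm L (weaken_elim t E)))
| comm_eps : forall d e (A : tm G Bot) (E : elim G d e),
    comm_rule (elim_tm (Eps d A) E) (Eps e A).

Inductive compat (P : Type)
    (R : forall (G : list (ty P)) (s : ty P), relation (tm G s)) :
    forall (G : list (ty P)) (s : ty P), relation (tm G s) :=
| compat_rule : forall G s (M M' : tm G s), R G s M M' -> compat R M M'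
| compat_lam : forall G s t (N N' : tm (s :: G) t),
    compat R N N' -> compat R (Lam N) (Lam N')
| compat_pair1 : forall G s t (M M' : tm G s) (N : tm G t),
    compat R M M' -> compat R (Pair M N) (Pair M' N)
| compat_pair2 : forall G s t (M : tm G s) (N N' : tm G t),
    compat R N N' -> compat R (Pair M N) (Pair M N')
| compat_in1 : forall G s t (A A' : tm G s),
    compat R A A' -> compat R (In1 t A) (In1 t A')
| compat_in2 : forall G s t (B B' : tm G t),
    compat R B B' -> compat R (In2 s B) (In2 s B')
| compat_app1 : forall G s t (M M' : tm G (Arr s t)) (N : tm G s),
    compat R M M' -> compat R (App M N) (App M' N)
| compat_app2 : forall G s t (M : tm G (Arr s t)) (N N' : tm G s),
    compat R N N' -> compat R (App M N) (App M N')
| compat_pi1 : forall G s t (A A' : tm G (And s t)),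
    compat R A A' -> compat R (Pi1 A) (Pi1 A')
| compat_pi2 : forall G s t (A A' : tm G (And s t)),
    compat R A A' -> compat R (Pi2 A) (Pi2 A')
| compat_case1 : forall G s t d (W W' : tm G (Or s t))
      (K : tm (s :: G) d) (L : tm (t :: G) d),
    compat R W W' -> compat R (Case W K L) (Case W' K L)
| compat_case2 : forall G s t d (W : tm G (Or s t))
      (K K' : tm (s :: G) d) (L : tm (t :: G) d),
    compat R K K' -> compat R (Case W K L) (Case W K' L)
| compat_case3 : forall G s t d (W : tm G (Or s t))
      (K : tm (s :: G) d) (L L' : tm (t :: G) d),
    compat R L L' -> compat R (Case W K L) (Case W K L')
| compat_eps : forall G t (A A' : tm G Bot),
    compat R A A' -> compat R (Eps t A) (Eps t A').

Definition beta (P : Type) (G : list (ty P)) (s : ty P) : relation (tm G s) :=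
  compat (@beta_rule P) (G := G) (s := s).

Definition comm (P : Type) (G : list (ty P)) (s : ty P) : relation (tm G s) :=
  compat (@comm_rule P) (G := G) (s := s).

Definition step (P : Type) (G : list (ty P)) (s : ty P) : relation (tm G s) :=
  union (tm G s) (@beta P G s) (@comm P G s).

(* Main.v *)
(** Types are erased to raw de Bruijn terms.  A type is interpreted by a set of
    stacks of eliminators, and a term is reducible when plugging it into each of
    these stacks gives a strongly normalizing term (biorthogonality).  Then
    eliminations preserve reducibility by mere reassociation, since
    [(M E) K = M (E :: K)], and a commutative conversion is a reduction of the
    stack alone, which merges two adjacent eliminators and shortens the stack.
    Merging [E] into [x.S, y.T] keeps [S[x:=A] K] unchanged, which is why a
    stack starting with a case analysis is strongly normalizing as soon as its
    branches are so when plugged into the rest. *)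
Require Import Defs.
From Stdlib Require Import List Relations Wf_nat Lia.
Import ListNotations.

(* Eliminators are terms too, so that one sort suffices; [RElim M E] is meant
   for [E] one of the last five constructors, but nothing enforces it. *)
Inductive raw : Type :=
| RVar : nat -> raw
| RLam : raw -> raw
| RPair : raw -> raw -> raw
| RIn1 : raw -> raw
| RIn2 : raw -> raw
| RElim : raw -> raw -> raw
| RApp : raw -> raw
| RPi1 : raw
| RPi2 : raw
| RCase : raw -> raw -> raw
| REps : raw.

(** * Renaming and substitution on raw terms *)

Definition rup (r : nat -> nat) (x : nat) : nat :=
  match x with 0 => 0 | S y => S (r y) end.

Fixpoint rren (r : nat -> nat) (M : raw) : raw :=
  match M with
  | RVar x => RVar (r x)
  | RLam N => RLam (rren (rup r) N)
  | RPair M N => RPair (rren r M) (rren r N)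
  | RIn1 A => RIn1 (rren r A)
  | RIn2 B => RIn2 (rren r B)
  | RElim M E => RElim (rren r M) (rren r E)
  | RApp N => RApp (rren r N)
  | RPi1 => RPi1
  | RPi2 => RPi2
  | RCase K L => RCase (rren (rup r) K) (rren (rup r) L)
  | REps => REps
  end.

Definition shift : raw -> raw := rren S.

Definition scons (A : raw) (f : nat -> raw) (x : nat) : raw :=
  match x with 0 => A | S y => f y end.

Definition up (f : nat -> raw) : nat -> raw :=
  scons (RVar 0) (fun x => shift (f x)).

Fixpoint rsubst (f : nat -> raw) (M : raw) : raw :=
  match M with
  | RVar x => f x
  | RLam N => RLam (rsubst (up f) N)
  | RPair M N => RPair (rsubst f M) (rsubst f N)
  | RIn1 A => RIn1 (rsubst f A)
  | RIn2 B => RIn2 (rsubst f B)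
  | RElim M E => RElim (rsubst f M) (rsubst f E)
  | RApp N => RApp (rsubst f N)
  | RPi1 => RPi1
  | RPi2 => RPi2
  | RCase K L => RCase (rsubst (up f) K) (rsubst (up f) L)
  | REps => REps
  end.

Definition inst (M A : raw) : raw := rsubst (scons A RVar) M.

(* Pointwise hypotheses, here and in the next lemmas, dispense with functional
   extensionality. *)
Lemma rren_rsubst_eq (M : raw) (r : nat -> nat) (f : nat -> raw) :
  (forall x, f x = RVar (r x)) -> rren r M = rsubst f M.
Proof.
  revert r f; induction M; intros r f H; simpl;
    try (now rewrite H); f_equal; auto;
    match goal with
    | IH : _ |- _ =>
        apply IH; intros [|x]; simpl; rewrite ?H; reflexivity
    end.
Qed.

Lemma rsubst_rren (M : raw) (r : nat -> nat) (f g : nat -> raw) :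
  (forall x, g x = f (r x)) -> rsubst f (rren r M) = rsubst g M.
Proof.
  revert r f g; induction M; intros r f g H; simpl;
    try (now rewrite H); f_equal; auto;
    match goal with
    | IH : _ |- _ =>
        apply IH; intros [|x]; simpl; rewrite ?H; reflexivity
    end.
Qed.

Lemma rren_rren (M : raw) (r q p : nat -> nat) :
  (forall x, p x = q (r x)) -> rren q (rren r M) = rren p M.
Proof.
  intros H.
  rewrite (rren_rsubst_eq _ q (fun x => RVar (q x))) by reflexivity.
  rewrite (rsubst_rren _ r _ (fun x => RVar (q (r x)))) by reflexivity.
  symmetry; apply rren_rsubst_eq; intros x; now rewrite H.
Qed.

Lemma rren_rsubst (M : raw) (r : nat -> nat) (f g : nat -> raw) :
  (forall x, g x = rren r (f x)) -> rren r (rsubst f M) = rsubst g M.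
Proof.
  revert r f g; induction M; intros r f g H; simpl;
    try (now rewrite H); f_equal; auto;
    match goal with
    | IH : _ |- _ =>
        apply IH; intros [|x]; simpl; [reflexivity|];
        rewrite H; unfold shift;
        rewrite !(rren_rren _ _ _ (fun x => S (r x))) by reflexivity;
        reflexivity
    end.
Qed.

(** Under a binder, [up g] meets a shifted term; the mixed laws [rren_rsubst] and [rsubst_rren] move
    the shift across. *)
Lemma rsubst_rsubst (M : raw) (f g h : nat -> raw) :
  (forall x, h x = rsubst g (f x)) -> rsubst g (rsubst f M) = rsubst h M.
Proof.
  revert f g h; induction M; intros f g h H; simpl;
    try (now rewrite H); f_equal; auto;
    match goal with
    | IH : _ |- _ =>
        apply IH; intros [|x]; simpl; [reflexivity|];
        rewrite H; unfold shift;
        rewrite (rren_rsubst _ _ _ (fun x => shift (g x))) by reflexivity;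
        symmetry; apply rsubst_rren; reflexivity
    end.
Qed.

Lemma rsubst_id (M : raw) (f : nat -> raw) :
  (forall x, f x = RVar x) -> rsubst f M = M.
Proof.
  revert f; induction M; intros f H; simpl;
    try (now rewrite H); f_equal; auto;
    match goal with
    | IH : _ |- _ =>
        apply IH; intros [|x]; simpl; rewrite ?H; reflexivity
    end.
Qed.

Lemma inst_shift (M A : raw) : inst (shift M) A = M.
Proof.
  unfold inst, shift; rewrite (rsubst_rren _ _ _ RVar) by reflexivity.
  now apply rsubst_id.
Qed.

Lemma rsubst_up_shift (M : raw) (f : nat -> raw) :
  rsubst (up f) (shift M) = shift (rsubst f M).
Proof.
  unfold shift.
  rewrite (rsubst_rren _ _ _ (fun x => shift (f x))) by reflexivity.
  symmetry; now apply rren_rsubst.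
Qed.

Lemma inst_rsubst_up (M A : raw) (f : nat -> raw) :
  inst (rsubst (up f) M) A = rsubst (scons A f) M.
Proof.
  apply rsubst_rsubst; intros [|x]; simpl; [reflexivity|].
  symmetry; apply inst_shift.
Qed.

Lemma rsubst_inst (M A : raw) (f : nat -> raw) :
  rsubst f (inst M A) = inst (rsubst (up f) M) (rsubst f A).
Proof.
  rewrite inst_rsubst_up; apply rsubst_rsubst; now intros [|x].
Qed.

(** * Reduction of raw terms *)

Inductive rbeta : raw -> raw -> raw -> Prop :=
| rbeta_lam : forall N A, rbeta (RLam N) (RApp A) (inst N A)
| rbeta_pi1 : forall M N, rbeta (RPair M N) RPi1 M
| rbeta_pi2 : forall M N, rbeta (RPair M N) RPi2 N
| rbeta_in1 : forall A K L, rbeta (RIn1 A) (RCase K L) (inst K A)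
| rbeta_in2 : forall B K L, rbeta (RIn2 B) (RCase K L) (inst L B).

(** As in [rbeta], a redex is split into a term and an eliminator, so that contractions at the
    junction of a plugged term and its stack can be singled out. In [rcomm_eps] the change of target
    type is invisible, types being erased. *)
Inductive rcomm : raw -> raw -> raw -> Prop :=
| rcomm_case : forall W K L E,
    rcomm (RElim W (RCase K L)) E
          (RElim W (RCase (RElim K (shift E)) (RElim L (shift E))))
| rcomm_eps : forall A E, rcomm (RElim A REps) E (RElim A REps).

Inductive rstep : raw -> raw -> Prop :=
| rstep_beta : forall M E Z, rbeta M E Z -> rstep (RElim M E) Z
| rstep_comm : forall M E Z, rcomm M E Z -> rstep (RElim M E) Z
| rstep_lam : forall N N', rstep N N' -> rstep (RLam N) (RLam N')
| rstep_pair1 : forall M M' N, rstep M M' -> rstep (RPair M N) (RPair M' N)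
| rstep_pair2 : forall M N N', rstep N N' -> rstep (RPair M N) (RPair M N')
| rstep_in1 : forall A A', rstep A A' -> rstep (RIn1 A) (RIn1 A')
| rstep_in2 : forall B B', rstep B B' -> rstep (RIn2 B) (RIn2 B')
| rstep_elim1 : forall M M' E, rstep M M' -> rstep (RElim M E) (RElim M' E)
| rstep_elim2 : forall M E E', rstep E E' -> rstep (RElim M E) (RElim M E')
| rstep_app : forall N N', rstep N N' -> rstep (RApp N) (RApp N')
| rstep_case1 : forall K K' L, rstep K K' -> rstep (RCase K L) (RCase K' L)
| rstep_case2 : forall K L L', rstep L L' -> rstep (RCase K L) (RCase K L').

Local Hint Constructors rbeta rcomm rstep : core.

Lemma rbeta_rsubst (M E Z : raw) (f : nat -> raw) :
  rbeta M E Z -> rbeta (rsubst f M) (rsubst f E) (rsubst f Z).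
Proof.
  intros H; destruct H; simpl; rewrite ?rsubst_inst; constructor.
Qed.

Lemma rcomm_rsubst (M E Z : raw) (f : nat -> raw) :
  rcomm M E Z -> rcomm (rsubst f M) (rsubst f E) (rsubst f Z).
Proof.
  intros H; destruct H; simpl; rewrite ?rsubst_up_shift; constructor.
Qed.

Lemma rstep_rsubst (M M' : raw) (f : nat -> raw) :
  rstep M M' -> rstep (rsubst f M) (rsubst f M').
Proof.
  intros H; revert f; induction H; intros f; simpl;
    auto using rbeta_rsubst, rcomm_rsubst.
Qed.

Lemma rstep_shift (M M' : raw) : rstep M M' -> rstep (shift M) (shift M').
Proof.
  intros H; unfold shift.
  rewrite !(rren_rsubst_eq _ _ (fun x => RVar (S x))) by reflexivity.
  now apply rstep_rsubst.
Qed.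

Definition rsteps : raw -> raw -> Prop := clos_refl_trans _ rstep.

Lemma rsteps_map (C : raw -> raw) (M M' : raw) :
  (forall N N', rstep N N' -> rstep (C N) (C N')) ->
  rsteps M M' -> rsteps (C M) (C M').
Proof.
  intros HC; induction 1; [now apply rt_step, HC|apply rt_refl|].
  eapply rt_trans; eassumption.
Qed.

Lemma rsteps_map2 (C : raw -> raw -> raw) (M M' N N' : raw) :
  (forall M M' N, rstep M M' -> rstep (C M N) (C M' N)) ->
  (forall M N N', rstep N N' -> rstep (C M N) (C M N')) ->
  rsteps M M' -> rsteps N N' -> rsteps (C M N) (C M' N').
Proof.
  intros H1 H2 HM HN; apply rt_trans with (C M' N).
  - apply (rsteps_map (fun M => C M N)); auto.
  - apply (rsteps_map (C M')); auto.
Qed.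

Lemma rsteps_rsubst (M : raw) (f g : nat -> raw) :
  (forall x, rsteps (f x) (g x)) -> rsteps (rsubst f M) (rsubst g M).
Proof.
  assert (Hup : forall f g, (forall x, rsteps (f x) (g x)) ->
                forall x, rsteps (up f x) (up g x)).
  { intros f' g' H [|x]; simpl; [apply rt_refl|].
    apply rsteps_map; auto using rstep_shift. }
  revert f g; induction M; intros f g H; simpl;
    first [apply H | apply rt_refl | apply rsteps_map; now auto
          | apply rsteps_map2; now auto].
Qed.

(** One step for each occurrence of the variable, possibly none. In [rstep_rsubst], by contrast, a
    single step stays single, which the inductions on [sn] rely on. *)
Lemma rsteps_inst (M A A' : raw) :
  rstep A A' -> rsteps (inst M A) (inst M A').
Proof.
  intros H; apply rsteps_rsubst; intros [|x]; simpl;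
    [now apply rt_step|apply rt_refl].
Qed.

(** * Strong normalization *)

Definition sn : raw -> Prop := Acc (fun M' M => rstep M M').

Lemma sn_rstep (M M' : raw) : sn M -> rstep M M' -> sn M'.
Proof. intros [H]; apply H. Qed.

Lemma sn_rsteps (M M' : raw) : sn M -> rsteps M M' -> sn M'.
Proof. intros HM H; revert HM; induction H; eauto using sn_rstep. Qed.

Lemma sn_reflect (C : raw -> raw) (M : raw) :
  (forall N N', rstep N N' -> rstep (C N) (C N')) -> sn (C M) -> sn M.
Proof.
  intros HC H; remember (C M) as Z eqn:EZ; revert M EZ.
  induction H as [Z _ IH]; intros M ->; constructor; intros M' HM.
  apply (IH (C M')); [now apply HC|reflexivity].
Qed.

Lemma sn_inst (M A : raw) : sn (inst M A) -> sn M.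
Proof.
  apply (sn_reflect (fun M => inst M A)); intros; now apply rstep_rsubst.
Qed.

Lemma sn_map (C : raw -> raw) (M : raw) :
  (forall M Z, rstep (C M) Z -> exists2 M', rstep M M' & Z = C M') ->
  sn M -> sn (C M).
Proof.
  intros HC; induction 1 as [M _ IH]; constructor; intros Z HZ.
  destruct (HC _ _ HZ) as [M' HM ->]; now apply IH.
Qed.

Lemma sn_pair (M N : raw) : sn M -> sn N -> sn (RPair M N).
Proof.
  intros HM; revert N; induction HM as [M HM IHM].
  induction 1 as [N HN IHN]; constructor; intros Z HZ; inversion HZ; subst.
  - apply IHM; [assumption|now constructor].
  - now apply IHN.
Qed.

(** * Stacks of eliminators and their reductions *)

Definition plug (M : raw) (K : list raw) : raw := fold_left RElim K M.

Lemma rstep_plug (M M' : raw) (K : list raw) :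
  rstep M M' -> rstep (plug M K) (plug M' K).
Proof. revert M M'; induction K; simpl; auto. Qed.

Lemma rsteps_plug (M M' : raw) (K : list raw) :
  rsteps M M' -> rsteps (plug M K) (plug M' K).
Proof.
  apply (rsteps_map (fun M => plug M K)); intros; now apply rstep_plug.
Qed.

Inductive kstep : list raw -> list raw -> Prop :=
| kstep_head : forall E E' K, rstep E E' -> kstep (E :: K) (E' :: K)
| kstep_tail : forall E K K', kstep K K' -> kstep (E :: K) (E :: K')
| kstep_case : forall S T E K,
    kstep (RCase S T :: E :: K)
          (RCase (RElim S (shift E)) (RElim T (shift E)) :: K)
| kstep_eps : forall E K, kstep (REps :: E :: K) (REps :: K).

Local Hint Constructors kstep : core.

(** Only merges change the length, and they shorten the stack. A bound on the length can thus be the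
    outermost measure in [ksn_eps] and [ksn_case]. *)
Lemma kstep_length (K K' : list raw) : kstep K K' -> length K' <= length K.
Proof. induction 1; simpl; lia. Qed.

Lemma rstep_plug_kstep (M : raw) (K K' : list raw) :
  kstep K K' -> rstep (plug M K) (plug M K').
Proof.
  intros H; revert M; induction H; intros M; simpl; auto using rstep_plug.
Qed.

Definition ksn : list raw -> Prop := Acc (fun K' K => kstep K K').

(** Variables are included: the point is that such a term is not an elimination, so no commutative
    rule applies between it and the first eliminator of a stack. *)
Inductive intro : raw -> Prop :=
| intro_var : forall x, intro (RVar x)
| intro_lam : forall N, intro (RLam N)
| intro_pair : forall M N, intro (RPair M N)
| intro_in1 : forall A, intro (RIn1 A)
| intro_in2 : forall B, intro (RIn2 B).

Inductive eliminator : raw -> Prop :=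
| eliminator_app : forall N, eliminator (RApp N)
| eliminator_pi1 : eliminator RPi1
| eliminator_pi2 : eliminator RPi2
| eliminator_case : forall K L, eliminator (RCase K L)
| eliminator_eps : eliminator REps.

Local Hint Constructors intro eliminator : core.

Lemma intro_rstep (M M' : raw) : intro M -> rstep M M' -> intro M'.
Proof. intros H HM; destruct H; inversion HM; auto. Qed.

Lemma eliminator_rstep (E E' : raw) :
  eliminator E -> rstep E E' -> eliminator E'.
Proof. intros H HE; destruct H; inversion HE; auto. Qed.

Lemma rstep_plug_inv (M Z : raw) (K : list raw) :
  rstep (plug M K) Z ->
  (exists2 M', rstep M M' & Z = plug M' K) \/
  (exists2 K', kstep K K' & Z = plug M K') \/
  (exists E K' M', K = E :: K' /\ (rbeta M E M' \/ rcomm M E M') /\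
                   Z = plug M' K').
Proof.
  revert M; induction K as [|E K IH]; intros M H; simpl in *; [eauto|].
  destruct (IH _ H)
    as [[M' HM ->]|[[K' HK ->]|[E' [K' [M' [-> [[HM|HM] ->]]]]]]].
  - inversion HM; subst; eauto 10.
  - right; left; exists (E :: K'); auto.
  - inversion HM.
  (* A commutative redex formed by [RElim M E] and the next eliminator leaves [M] alone: it merges
     [E] with that eliminator inside the stack. *)
  - right; left; inversion HM; subst.
    + eexists; [apply kstep_case|reflexivity].
    + eexists; [apply kstep_eps|reflexivity].
Qed.

(** * Strongly normalizing stacks *)

Lemma ksn_nil : ksn [].
Proof. constructor; intros K H; inversion H. Qed.

Lemma ksn_tail (E : raw) (K : list raw) : ksn (E :: K) -> ksn K.
Proof.
  intros H; remember (E :: K) as K1 eqn:E1; revert K E1.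
  induction H as [K1 _ IH]; intros K ->; constructor; intros K' HK.
  apply (IH (E :: K')); [now constructor|reflexivity].
Qed.

Lemma sn_plug_var (x : nat) (K : list raw) : ksn K -> sn (plug (RVar x) K).
Proof.
  induction 1 as [K _ IH]; constructor; intros Z HZ.
  destruct (rstep_plug_inv _ _ _ HZ)
    as [[M' HM ->]|[[K' HK ->]|[E [K' [M' [-> [[HM|HM] ->]]]]]]];
    try (now inversion HM); now apply IH.
Qed.

Lemma ksn_app (N : raw) (K : list raw) : sn N -> ksn K -> ksn (RApp N :: K).
Proof.
  intros HN; revert K; induction HN as [N HN IHN].
  induction 1 as [K HK IHK]; constructor; intros Z HZ; inversion HZ; subst.
  - match goal with H : rstep (RApp _) _ |- _ => inversion H; subst end.
    apply IHN; [assumption|now constructor].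
  - now apply IHK.
Qed.

Lemma ksn_pi1 (K : list raw) : ksn K -> ksn (RPi1 :: K).
Proof.
  induction 1 as [K HK IHK]; constructor; intros Z HZ; inversion HZ; subst.
  - match goal with H : rstep RPi1 _ |- _ => inversion H end.
  - now apply IHK.
Qed.

Lemma ksn_pi2 (K : list raw) : ksn K -> ksn (RPi2 :: K).
Proof.
  induction 1 as [K HK IHK]; constructor; intros Z HZ; inversion HZ; subst.
  - match goal with H : rstep RPi2 _ |- _ => inversion H end.
  - now apply IHK.
Qed.

(** Lexicographic induction on a bound for the length of [K], then on [ksn K]. A merge drops the
    first eliminator of [K]; this is not a reduction of [K], but it decreases the length. *)
Lemma ksn_eps (K : list raw) : ksn K -> ksn (REps :: K).
Proof.
  remember (length K) as n eqn:En; assert (Hn : length K <= n) by lia; clear En.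
  revert K Hn; induction n as [n IHn] using lt_wf_ind.
  intros K Hn HK; induction HK as [K HK IHK].
  constructor; intros Z HZ; inversion HZ as [? ? ? H|? ? ? H| |]; subst.
  - inversion H.
  - apply IHK; [assumption|apply kstep_length in H; lia].
  - apply (IHn (length K0)); simpl in Hn; try lia.
    apply (ksn_tail E); now constructor.
Qed.

(** Lexicographic induction on a bound for the length of [K], then on the two plugged terms. A
    reduction of [S], [T] or [K] is a step of at least one of them; a merge leaves both unchanged,
    since instantiation cancels [shift E], but shortens the stack. *)
Lemma ksn_case (S T A B : raw) (K : list raw) :
  sn (plug (inst S A) K) -> sn (plug (inst T B) K) -> ksn (RCase S T :: K).
Proof.
  remember (length K) as n eqn:En; assert (Hn : length K <= n) by lia; clear En.
  revert S T K Hn; induction n as [n IHn] using lt_wf_ind; intros S T K Hn HS.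
  remember (plug (inst S A) K) as u eqn:Eu.
  revert S T K Hn Eu; induction HS as [u Hu IHu]; intros S T K Hn Eu HT.
  remember (plug (inst T B) K) as v eqn:Ev.
  revert T K Hn Eu Ev; induction HT as [v Hv IHv]; intros T K Hn -> ->.
  assert (Hv' : sn (plug (inst T B) K)) by now constructor.
  constructor; intros Z HZ; inversion HZ as [? ? ? H|? ? ? H| |]; subst.
  - inversion H; subst.
    + eapply IHu; [apply rstep_plug, rstep_rsubst; eassumption
                  |eassumption|reflexivity|assumption].
    + eapply IHv; [apply rstep_plug, rstep_rsubst; eassumption
                  |eassumption|reflexivity|reflexivity].
  (* Both plugged terms reduce at once: the descent is on the first, and the second has only to
     remain strongly normalizing. *)
  - eapply IHu; [apply rstep_plug_kstep; eassumption| |reflexivity|].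
    + apply kstep_length in H; lia.
    + eapply sn_rstep; [eassumption|now apply rstep_plug_kstep].
  - simpl in Hn, Hu, Hv'; eapply (IHn (length K0)); [lia|lia| |].
    + change (sn (plug (RElim (inst S A) (inst (shift E) A)) K0)).
      rewrite inst_shift; now constructor.
    + change (sn (plug (RElim (inst T B) (inst (shift E) B)) K0)).
      now rewrite inst_shift.
Qed.

(** The contraction may erase the reduced subterm, as in the discarded half of a pair, or copy it,
    as in an injected term; hence [rsteps] in the conclusion. *)
Lemma rstep_rbeta_swap_l (M M' E Z' : raw) :
  intro M -> rstep M M' -> rbeta M' E Z' ->
  exists2 Z, rbeta M E Z & rsteps Z Z'.
Proof.
  intros HI HM HB; destruct HI; inversion HM; subst; inversion HB; subst;
    eexists; try (now constructor);
    first [ apply rt_refl | apply rsteps_inst; assumption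
          | apply rt_step; first [assumption | now apply rstep_rsubst] ].
Qed.

(* Without the first hypothesis, [E] could be a redex that contracts to an
   eliminator, since raw terms are not sorted. *)
Lemma rstep_rbeta_swap_r (M E E' Z' : raw) :
  eliminator E -> rstep E E' -> rbeta M E' Z' ->
  exists2 Z, rbeta M E Z & rsteps Z Z'.
Proof.
  intros HI HE HB; destruct HI; inversion HE; subst; inversion HB; subst;
    eexists; try (now constructor);
    first [ apply rt_refl | apply rsteps_inst; assumption
          | apply rt_step; first [assumption | now apply rstep_rsubst] ].
Qed.

(* A contraction that follows a reduction of [M] or [E] can be performed first,
   and merging [E] with the next eliminator commutes with the contraction: the
   last hypothesis is preserved by all reductions of [plug M (E :: K)]. *)
Lemma sn_plug_intro (M E : raw) (K : list raw) :
  intro M -> eliminator E -> sn M -> ksn (E :: K) ->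
  (forall Z, rbeta M E Z -> sn (plug Z K)) -> sn (plug M (E :: K)).
Proof.
  intros HI HE HM HK; revert E K HI HE HK.
  induction HM as [M HM IHM]; intros E K HI HE HK.
  remember (E :: K) as K1 eqn:EK; revert E K EK HE.
  induction HK as [K1 HK IHK]; intros E K -> HE HB.
  constructor; intros Z HZ.
  destruct (rstep_plug_inv _ _ _ HZ)
    as [[M' HM' ->]|[[K' HK' ->]|[E' [K' [M' [EK [[HM'|HM'] ->]]]]]]].
  - apply IHM; auto.
    + eapply intro_rstep; eassumption.
    + now constructor.
    + intros Z' HZ'; destruct (rstep_rbeta_swap_l _ _ _ _ HI HM' HZ') as [Z HZ1 HZ2].
      eapply sn_rsteps; [now apply HB, HZ1|now apply rsteps_plug].
  - inversion HK'; subst;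
      (eapply IHK;
         [eassumption|reflexivity|eauto using eliminator_rstep|]);
      intros Z' HZ'.
    + destruct (rstep_rbeta_swap_r M E E' Z') as [Z HZ1 HZ2]; auto.
      eapply sn_rsteps; [now apply HB, HZ1|now apply rsteps_plug].
    + eapply sn_rstep; [now apply HB, HZ'|now apply rstep_plug_kstep].
    + inversion HZ'; subst.
      * change (sn (plug (RElim (inst S A) (inst (shift E0) A)) K0)).
        rewrite inst_shift; apply (HB (inst S A)); constructor.
      * change (sn (plug (RElim (inst T B) (inst (shift E0) B)) K0)).
        rewrite inst_shift; apply (HB (inst T B)); constructor.
    + inversion HZ'.
  - injection EK as <- <-; now apply HB.
  (* A commutative redex at the junction would make [M] an elimination. *)
  - inversion HM'; subst; inversion HI.
Qed.

(** * Reducibility *)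

Definition orth (Q : list raw -> Prop) (M : raw) : Prop :=
  forall K, Q K -> sn (plug M K).

Fixpoint stacks (P : Type) (s : ty P) (K : list raw) : Prop :=
  match K with
  | [] => True
  | E :: K =>
      match s, E with
      | Arr s t, RApp N => orth (stacks P s) N /\ stacks P t K
      | And s t, RPi1 => stacks P s K
      | And s t, RPi2 => stacks P t K
      | Or s t, RCase U V =>
          (forall A, orth (stacks P s) A -> sn (plug (inst U A) K)) /\
          (forall B, orth (stacks P t) B -> sn (plug (inst V B) K))
      | Bot, REps => ksn K
      | _, _ => False
      end
  end.
Arguments stacks {P} s K.

Definition red (P : Type) (s : ty P) : raw -> Prop := orth (stacks s).
Arguments red {P} s M.

Lemma red_sn (P : Type) (s : ty P) (M : raw) : red s M -> sn M.
Proof. intros H; apply (H []); now destruct s. Qed.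

Lemma stacks_ksn (P : Type) (s : ty P) (K : list raw) : stacks s K -> ksn K.
Proof.
  revert K; induction s as [p|s IHs t IHt|s IHs t IHt|s IHs t IHt|];
    intros [|E K] H; try exact ksn_nil; destruct E; try contradiction.
  - destruct H as [HN HK]; apply ksn_app; [exact (red_sn _ _ _ HN)|auto].
  - apply ksn_pi1; auto.
  - apply ksn_pi2; auto.
  - destruct H as [HS HT].
    (* A variable is reducible at both [s] and [t] by the induction hypotheses, so it can
       instantiate either branch. *)
    apply (ksn_case _ _ (RVar 0) (RVar 0)); [apply HS|apply HT];
      intros K' HK'; apply sn_plug_var; auto.
  - now apply ksn_eps.
Qed.

Lemma red_var (P : Type) (s : ty P) (x : nat) : red s (RVar x).
Proof. intros K HK; apply sn_plug_var; exact (stacks_ksn _ _ _ HK). Qed.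

Lemma red_lam (P : Type) (s t : ty P) (N : raw) :
  (forall A, red s A -> red t (inst N A)) -> red (Arr s t) (RLam N).
Proof.
  intros HN.
  assert (Hsn : sn (RLam N)).
  { apply sn_map; [intros M Z H; inversion H; subst; eauto|].
    (* The body normalizes because its instance at a variable, itself reducible, does. *)
    apply (sn_inst _ (RVar 0)), (red_sn _ t), HN, red_var. }
  intros [|E K] HK; [assumption|].
  apply sn_plug_intro; auto; [now destruct E|exact (stacks_ksn _ _ _ HK)|].
  destruct E; try contradiction; destruct HK as [HA HK].
  intros Z HZ; inversion HZ; subst; now apply HN.
Qed.

Lemma red_pair (P : Type) (s t : ty P) (M N : raw) :
  red s M -> red t N -> red (And s t) (RPair M N).
Proof.
  intros HM HN.
  assert (Hsn : sn (RPair M N)) by (apply sn_pair; eauto using red_sn).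
  intros [|E K] HK; [assumption|].
  apply sn_plug_intro; auto; [now destruct E|exact (stacks_ksn _ _ _ HK)|].
  intros Z HZ; inversion HZ; subst; auto.
Qed.

Lemma red_in1 (P : Type) (s t : ty P) (A : raw) :
  red s A -> red (Or s t) (RIn1 A).
Proof.
  intros HA.
  assert (Hsn : sn (RIn1 A)).
  { apply sn_map; [intros M Z H; inversion H; subst; eauto|].
    eauto using red_sn. }
  intros [|E K] HK; [assumption|].
  apply sn_plug_intro; auto; [now destruct E|exact (stacks_ksn _ _ _ HK)|].
  intros Z HZ; inversion HZ; subst; now apply HK.
Qed.

Lemma red_in2 (P : Type) (s t : ty P) (B : raw) :
  red t B -> red (Or s t) (RIn2 B).
Proof.
  intros HB.
  assert (Hsn : sn (RIn2 B)).
  { apply sn_map; [intros M Z H; inversion H; subst; eauto|].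
    eauto using red_sn. }
  intros [|E K] HK; [assumption|].
  apply sn_plug_intro; auto; [now destruct E|exact (stacks_ksn _ _ _ HK)|].
  intros Z HZ; inversion HZ; subst; now apply HK.
Qed.

(** * Erasure of types *)

Fixpoint index (P : Type) (G : list (ty P)) (s : ty P) (x : var G s) : nat :=
  match x with
  | VZ => 0
  | VS _ y => S (index _ _ _ y)
  end.
Arguments index {P G s} x.

Fixpoint erase (P : Type) (G : list (ty P)) (s : ty P) (M : tm G s) : raw :=
  match M with
  | Var x => RVar (index x)
  | Lam N => RLam (erase _ _ _ N)
  | Pair M N => RPair (erase _ _ _ M) (erase _ _ _ N)
  | In1 _ A => RIn1 (erase _ _ _ A)
  | In2 _ B => RIn2 (erase _ _ _ B)
  | App M N => RElim (erase _ _ _ M) (RApp (erase _ _ _ N))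
  | Pi1 M => RElim (erase _ _ _ M) RPi1
  | Pi2 M => RElim (erase _ _ _ M) RPi2
  | Case W K L =>
      RElim (erase _ _ _ W) (RCase (erase _ _ _ K) (erase _ _ _ L))
  | Eps _ A => RElim (erase _ _ _ A) REps
  end.
Arguments erase {P G s} M.

Definition erase_elim (P : Type) (G : list (ty P)) (s t : ty P)
    (E : elim G s t) : raw :=
  match E with
  | EApp _ N => RApp (erase N)
  | EPi1 _ _ => RPi1
  | EPi2 _ _ => RPi2
  | ECase K L => RCase (erase K) (erase L)
  | EEps _ => REps
  end.
Arguments erase_elim {P G s t} E.

(** The return type of the match is computed from the context and is trivial on the empty one; [Q]
    is abstracted inside it because its type depends on the head and tail. *)
Lemma var_cons_ind (P : Type) (G : list (ty P)) (u : ty P)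
    (Q : forall s, var (u :: G) s -> Prop) :
  Q u VZ -> (forall s (x : var G s), Q s (VS u x)) ->
  forall s (x : var (u :: G) s), Q s x.
Proof.
  intros HZ HS s x.
  refine (match x as x0 in var G' s' return
            match G' return var G' s' -> Prop with
            | [] => fun _ => True
            | u' :: G0 => fun x =>
                forall Q : (forall s, var (u' :: G0) s -> Prop),
                Q u' VZ -> (forall s (x : var G0 s), Q s (VS u' x)) -> Q s' x
            end x0
          with VZ => _ | VS _ y => _ end Q HZ HS); auto.
Qed.

Lemma erase_rename (P : Type) (G D : list (ty P)) (s : ty P) (M : tm G s)
    (r : renaming G D) (q : nat -> nat) :
  (forall t (x : var G t), index (r t x) = q (index x)) ->
  erase (rename r M) = rren q (erase M).
Proof.
  revert D r q; induction M; intros D r q H; simpl; repeat f_equal; auto;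
    match goal with
    | IH : _ |- _ =>
        apply IH; apply var_cons_ind; simpl; intros; f_equal; auto
    end.
Qed.

Lemma erase_weaken (P : Type) (G : list (ty P)) (u s : ty P) (M : tm G s) :
  erase (weaken u M) = shift (erase M).
Proof. now apply erase_rename. Qed.

Lemma erase_subst (P : Type) (G D : list (ty P)) (s : ty P) (M : tm G s)
    (f : substitution G D) (g : nat -> raw) :
  (forall t (x : var G t), erase (f t x) = g (index x)) ->
  erase (subst f M) = rsubst g (erase M).
Proof.
  revert D f g; induction M; intros D f g H; simpl; repeat f_equal; auto;
    match goal with
    | IH : _ |- _ =>
        apply IH; apply var_cons_ind; simpl; intros;
        rewrite ?erase_weaken, ?H; reflexivity
    end.
Qed.

Lemma erase_subst0 (P : Type) (G : list (ty P)) (u s : ty P)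
    (M : tm (u :: G) s) (A : tm G u) :
  erase (subst0 M A) = inst (erase M) (erase A).
Proof. apply erase_subst; now apply var_cons_ind. Qed.

Lemma erase_elim_tm (P : Type) (G : list (ty P)) (s t : ty P)
    (M : tm G s) (E : elim G s t) :
  erase (elim_tm M E) = RElim (erase M) (erase_elim E).
Proof. now destruct E. Qed.

Lemma erase_weaken_elim (P : Type) (G : list (ty P)) (u s t : ty P)
    (E : elim G s t) :
  erase_elim (weaken_elim u E) = shift (erase_elim E).
Proof.
  destruct E; simpl; rewrite ?erase_weaken; try reflexivity.
  unfold shift; simpl; f_equal; apply erase_rename; now apply var_cons_ind.
Qed.

Lemma rstep_erase_compat (P : Type)
    (R : forall (G : list (ty P)) (s : ty P), relation (tm G s)) :
  (forall G s (M M' : tm G s), R G s M M' -> rstep (erase M) (erase M')) ->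
  forall G s (M M' : tm G s), compat R M M' -> rstep (erase M) (erase M').
Proof. intros HR; induction 1; simpl; auto. Qed.

(** Each typed step becomes exactly one raw step, never zero, so an infinite typed sequence erases
    to an infinite raw one. *)
Lemma rstep_erase (P : Type) (G : list (ty P)) (s : ty P) (M M' : tm G s) :
  step M M' -> rstep (erase M) (erase M').
Proof.
  intros [H|H]; revert H; apply rstep_erase_compat; clear.
  - intros G s M M' H; destruct H; simpl; rewrite ?erase_subst0; auto.
  - intros G s M M' H; destruct H; simpl;
      rewrite ?erase_elim_tm; simpl;
      rewrite ?erase_elim_tm, ?erase_weaken_elim; auto.
Qed.

(** * Reducibility of all erased terms, and the conclusion *)

Lemma red_erase (P : Type) (G : list (ty P)) (s : ty P) (M : tm G s)
    (f : nat -> raw) :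
  (forall t (x : var G t), red t (f (index x))) -> red s (rsubst f (erase M)).
Proof.
  (* Binder case: instantiating a body after [up f] is the same as applying the substitution
     [scons A f], which is again reducible. *)
  assert (Hscons : forall (D : list (ty P)) (u t : ty P) (N : tm (u :: D) t) f,
    (forall t (x : var D t), red t (f (index x))) ->
    (forall f, (forall t (x : var (u :: D) t), red t (f (index x))) ->
       red t (rsubst f (erase N))) ->
    forall A, red u A -> red t (inst (rsubst (up f) (erase N)) A)).
  { intros D u t N h Hh HN A HA; rewrite inst_rsubst_up; apply HN.
    now apply var_cons_ind. }
  revert f; induction M; intros f Hf; simpl.
  - apply Hf.
  - apply red_lam; eauto.
  - apply red_pair; auto.
  - apply red_in1; auto.
  - apply red_in2; auto.
  (* In this and the following cases the eliminator is pushed onto [K], and the induction hypothesis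
     for the eliminated term is used at the longer stack. *)
  - intros K HK; apply (IHM1 f Hf (_ :: K)).
    split; [exact (IHM2 f Hf)|exact HK].
  - intros K HK; now apply (IHM f Hf (_ :: K)).
  - intros K HK; now apply (IHM f Hf (_ :: K)).
  - intros K HK; apply (IHM1 f Hf (_ :: K)); split; intros A HA;
      eapply Hscons; eauto.
  - intros K HK; apply (IHM f Hf (_ :: K)); exact (stacks_ksn _ _ _ HK).
Qed.

Theorem theorem14 (P : Type) (G : list (ty P)) (s : ty P) (M : tm G s) :
  ~ exists f : nat -> tm G s, f 0 = M /\ forall n : nat, step (f n) (f (S n)).
Proof.
  intros [f [_ Hf]].
  assert (H : sn (erase (f 0))).
  { apply (red_sn _ s).
    rewrite <- (rsubst_id (erase (f 0)) RVar) by reflexivity.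
    apply red_erase; intros; apply red_var. }
  remember (erase (f 0)) as N eqn:EN.
  (* The induction on accessibility needs an arbitrary position in the sequence instead of the first
     one. *)
  assert (Hn : exists n, N = erase (f n)) by eauto; clear EN.
  induction H as [N _ IH]; destruct Hn as [n ->].
  apply (IH (erase (f (S n)))); eauto using rstep_erase.
Qed.
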